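(* Let $P$ be a finite poset. Then the following are equivalent: (i) There exists a finite, atomistic, lower bounded lattice $L$ such that $\mathrm{Con}\,L\cong \mathrm{H}(P)$. (ii) There exists a finite lower bounded lattice $L$ such that $\mathrm{Con}\,L\cong \mathrm{H}(P)$. (iii) $P$ is spike-free.
   Context: For a finite poset $P$, $\mathrm{H}(P)$ is the lattice of hereditary subsets (down-sets) of $P$, ordered by inclusion. A spike of $P$ is a pair $\langle p,q\rangle$ of elements of $P$ such that $q$ is a maximal element of $P$ and $q$ is the unique element of $P$ that covers $p$; $P$ is spike-free if it has no spikes. $\mathrm{Con}\,L$ is the congruence lattice of $L$. A finite lattice is atomistic if every element is a (finite, possibly empty) join of atoms. For a finite lattice $L$, $\mathrm{J}(L)$ is the set of all (nonzero) join-irreducible elements of $L$; for $q\in \mathrm{J}(L)$, $q_*$ denotes the unique element of $L$ covered by $q$. The join-dependency relation $D_L$ is the binary relation on $\mathrm{J}(L)$ defined by: $p\mathrel{D_L}q$ if and only if $p\neq q$ and there exists $x\in L$ such that $p\leq q\vee x$ and $p\nleq q_*\vee x$. A finite lattice $L$ is lower bounded if and only if it has no $D_L$-cycle, i.e. there are no $n\geq 1$ and $p_0,\dots,p_{n}\in \mathrm{J}(L)$ with $p_0\mathrel{D_L}p_1\mathrel{D_L}\cdots\mathrel{D_L}p_n=p_0$. *)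

(* Defs.v *)
From HB Require Import structures.
From mathcomp Require Import all_boot all_order.

Set Implicit Arguments.
Unset Strict Implicit.
Unset Printing Implicit Defensive.

Import Order.LTheory.

Local Open Scope order_scope.

Definition covers d (T : finPOrderType d) (x y : T) : bool :=
  (x < y) && [forall z : T, ~~ (x < z < y)].

Section HereditarySubsets.
Context d (P : finPOrderType d).

Definition hereditary (A : {set P}) : bool :=
  [forall x : P, forall y : P, (x <= y) && (y \in A) ==> (x \in A)].

Lemma hereditaryP (A : {set P}) :
  reflect (forall x y : P, x <= y -> y \in A -> x \in A) (hereditary A).
Proof.
apply: (iffP 'forall_forallP) => hA x y.
  by move=> lexy yA; apply: (implyP (hA x y)); rewrite lexy.
by apply/implyP => /andP[]; apply: hA.
Qed.

Record downset := Downset {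
  downset_set :> {set P};
  downset_hereditary : hereditary downset_set
}.

HB.instance Definition _ := [isSub for downset_set].
HB.instance Definition _ := [Finite of downset by <:].

Implicit Types A B C : downset.

Definition downset_le A B : bool := (A : {set P}) \subset B.

Fact downset_le_refl : reflexive downset_le.
Proof. by move=> A; apply: subxx. Qed.

Fact downset_le_anti : antisymmetric downset_le.
Proof. by move=> A B; rewrite /downset_le -eqEsubset => /eqP/val_inj. Qed.

Fact downset_le_trans : transitive downset_le.
Proof. by move=> B A C; apply: subset_trans. Qed.

HB.instance Definition _ :=
  Order.Le_isPOrder.Build Order.SetSubsetOrder.subset_display downset
    downset_le_refl downset_le_anti downset_le_trans.

Fact downset_meet_subproof A B : hereditary (A :&: B).
Proof.
apply/hereditaryP => x y lexy; rewrite !inE => /andP[yA yB].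
by rewrite (hereditaryP _ (valP A) _ _ lexy yA)
           (hereditaryP _ (valP B) _ _ lexy yB).
Qed.

Fact downset_join_subproof A B : hereditary (A :|: B).
Proof.
apply/hereditaryP => x y lexy; rewrite !inE => /orP[yA|yB].
  by rewrite (hereditaryP _ (valP A) _ _ lexy yA).
by rewrite (hereditaryP _ (valP B) _ _ lexy yB) orbT.
Qed.

Definition downset_meet A B := Downset (downset_meet_subproof A B).
Definition downset_join A B := Downset (downset_join_subproof A B).

Fact downset_meetP A B C : (A <= downset_meet B C) = (A <= B) && (A <= C).
Proof. exact: subsetI. Qed.

Fact downset_joinP A B C : (downset_join A B <= C) = (A <= C) && (B <= C).
Proof. exact: subUset. Qed.

HB.instance Definition _ :=
  Order.POrder_MeetJoin_isLattice.Build Order.SetSubsetOrder.subset_display downset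
    downset_meetP downset_joinP.

End HereditarySubsets.

Section Congruences.
Context d (L : finLatticeType d).

Definition is_congruence (R : {set L * L}) : bool :=
  [&& [forall x : L, (x, x) \in R],
      [forall x : L, forall y : L, ((x, y) \in R) ==> ((y, x) \in R)],
      [forall x : L, forall y : L, forall z : L,
         ((x, y) \in R) && ((y, z) \in R) ==> ((x, z) \in R)]
    & [forall x : L, forall x' : L, forall y : L, forall y' : L,
         ((x, x') \in R) && ((y, y') \in R) ==>
         ((x `&` y, x' `&` y') \in R) && ((x `|` y, x' `|` y') \in R)]].

Lemma is_congruenceP (R : {set L * L}) :
  reflect [/\ forall x, (x, x) \in R,
              forall x y, (x, y) \in R -> (y, x) \in R,
              forall x y z, (x, y) \in R -> (y, z) \in R -> (x, z) \in R
            & forall x x' y y', (x, x') \in R -> (y, y') \in R ->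
                (x `&` y, x' `&` y') \in R /\ (x `|` y, x' `|` y') \in R]
          (is_congruence R).
Proof.
apply: (iffP and4P) => -[/forallP rR sR tR cR]; split=> //.
- by move=> x y; move/forallP/(_ x)/forallP/(_ y)/implyP: sR.
- move=> x y z xy yz.
  by move/forallP/(_ x)/forallP/(_ y)/forallP/(_ z)/implyP: tR; apply; rewrite xy.
- move=> x x' y y' xx' yy'; apply/andP.
  move/forallP/(_ x)/forallP/(_ x')/forallP/(_ y)/forallP/(_ y')/implyP: cR.
  by apply; rewrite xx'.
- by apply/forallP => x; apply/forallP => y; apply/implyP; apply: sR.
- apply/forallP => x; apply/forallP => y; apply/forallP => z.
  by apply/implyP => /andP[]; apply: tR.
- apply/forallP => x; apply/forallP => x'; apply/forallP => y.
  apply/forallP => y'; apply/implyP => /andP[xx' yy'].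
  by apply/andP; apply: cR.
Qed.

Record congruence := Congruence {
  congruence_set :> {set L * L};
  congruence_is_congruence : is_congruence congruence_set
}.

HB.instance Definition _ := [isSub for congruence_set].
HB.instance Definition _ := [Finite of congruence by <:].

Implicit Types R S T : congruence.

Definition congruence_le R S : bool := (R : {set L * L}) \subset S.

Fact congruence_le_refl : reflexive congruence_le.
Proof. by move=> R; apply: subxx. Qed.

Fact congruence_le_anti : antisymmetric congruence_le.
Proof. by move=> R S; rewrite /congruence_le -eqEsubset => /eqP/val_inj. Qed.

Fact congruence_le_trans : transitive congruence_le.
Proof. by move=> S R T; apply: subset_trans. Qed.

HB.instance Definition _ :=
  Order.Le_isPOrder.Build Order.SetSubsetOrder.subset_display congruence
    congruence_le_refl congruence_le_anti congruence_le_trans.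

Lemma is_congruence_bigcap (F : pred {set L * L}) :
    (forall U, F U -> is_congruence U) ->
  is_congruence (\bigcap_(U | F U) U).
Proof.
move=> congF; apply/is_congruenceP; split.
- by move=> x; apply/bigcapP => R FR; have /is_congruenceP[] := congF R FR.
- move=> x y /bigcapP xy; apply/bigcapP => R FR.
  by have /is_congruenceP[_ + _ _] := congF R FR; apply; apply: xy.
- move=> x y z /bigcapP xy /bigcapP yz; apply/bigcapP => R FR.
  have /is_congruenceP[_ _ + _] := congF R FR.
  by apply; [apply: xy | apply: yz].
move=> x x' y y' /bigcapP xx' /bigcapP yy'.
have compat U : F U ->
    ((x `&` y, x' `&` y') \in U) /\ ((x `|` y, x' `|` y') \in U).
  move=> FU; have /is_congruenceP[_ _ _] := congF U FU.
  by apply; [apply: xx' | apply: yy'].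
by split; apply/bigcapP => R /compat[].
Qed.

Fact congruence_meet_subproof R S : is_congruence (R :&: S).
Proof.
have -> : R :&: S = \bigcap_(U in [set val R; val S]) U.
  apply/setP => x; rewrite inE; apply/andP/bigcapP => [[xR xS] T|xT].
    by rewrite !inE => /orP[]/eqP->.
  by split; apply: xT; rewrite !inE eqxx ?orbT.
by apply: is_congruence_bigcap => T; rewrite !inE => /orP[]/eqP->; apply: valP.
Qed.

Fact congruence_join_subproof R S :
  is_congruence (\bigcap_(U | is_congruence U && (R :|: S \subset U)) U).
Proof. by apply: is_congruence_bigcap => T /andP[]. Qed.

Definition congruence_meet R S := Congruence (congruence_meet_subproof R S).
Definition congruence_join R S := Congruence (congruence_join_subproof R S).

Fact congruence_meetP R S T :
  (R <= congruence_meet S T) = (R <= S) && (R <= T).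
Proof. exact: subsetI. Qed.

Fact congruence_joinP R S T :
  (congruence_join R S <= T) = (R <= T) && (S <= T).
Proof.
rewrite -[RHS]subUset; apply/idP/idP => [|RST].
  by apply: subset_trans; apply/bigcapsP => U /andP[].
by apply: bigcap_inf; rewrite (valP T).
Qed.

HB.instance Definition _ :=
  Order.POrder_MeetJoin_isLattice.Build Order.SetSubsetOrder.subset_display congruence
    congruence_meetP congruence_joinP.

End Congruences.

Arguments downset {d} P.
Arguments congruence {d} L.

Definition lattice_isomorphic d d' (L : latticeType d) (L' : latticeType d') :
    Prop :=
  exists f : {lmorphism L -> L'}, bijective f.

Definition spike d (P : finPOrderType d) (p q : P) : Prop :=
  [/\ forall x : P, q <= x -> x = q,
      covers p q
    & forall r : P, covers p r -> r = q].

Definition spike_free d (P : finPOrderType d) : Prop :=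
  forall p q : P, ~ spike p q.

Section FiniteLattices.
Context d (L : finTBLatticeType d).
Implicit Types p q x : L.

Definition atom x : bool := covers \bot x.

Definition atomistic : Prop :=
  forall x, exists2 A : {set L},
    {in A, forall a, atom a} & x = \join_(a in A) a.

Definition join_irreducible p : bool :=
  (p != \bot) &&
  [forall x : L, forall y : L, (p == x `|` y) ==> (p == x) || (p == y)].

(* The default value only matters when [q] covers no element, hence never for
   join-irreducible [q]; see [coversE]. *)
Definition lower_cover q : L := odflt \bot [pick x | covers x q].

Lemma coversE q : join_irreducible q ->
  forall x, covers x q = (x == lower_cover q).
Proof.
case/andP => q_neq0 /'forall_forallP q_irr.
have cov_uniq x y : covers x q -> covers y q -> x = y.
  case/andP => ltxq /forallP covx /andP[ltyq /forallP covy].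
  have lejq : x `|` y <= q by rewrite leUx !ltW.
  have ltjq : x `|` y < q.
    rewrite lt_neqAle lejq andbT; apply/eqP => Ejq.
    by have := q_irr x y; rewrite Ejq eqxx /= => /orP[]/eqP Eq;
       move: ltxq ltyq; rewrite -Eq ltxx.
  have := covx (x `|` y); rewrite ltjq andbT lt_neqAle leUl andbT negbK.
  have := covy (x `|` y); rewrite ltjq andbT lt_neqAle leUr andbT negbK.
  by move=> /eqP<-/eqP.
have [x0 covx0] : exists x, covers x q.
  have lt0q : \bot < q by rewrite lt0x.
  case: (@arg_maxnP L \bot (fun x => x < q)
           (fun x => #|[set z : L | z <= x]|)) => // x ltxq xmax.
  exists x; rewrite /covers ltxq; apply/forallP => z; apply/negP.
  case/andP => ltxz ltzq; have := xmax _ ltzq; rewrite /= leqNgt => /negP; apply.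
  apply/proper_card/properP; split.
    by apply/subsetP => t; rewrite !inE => /le_trans; apply; apply: ltW.
  by exists z; rewrite !inE ?lexx // lt_geF.
rewrite /lower_cover; case: pickP => [y covy|/(_ x0)]; last by rewrite covx0.
by move=> x /=; apply/idP/eqP => [/cov_uniq|->//]; apply.
Qed.

Definition join_dependency p q : bool :=
  [&& join_irreducible p, join_irreducible q, p != q
    & [exists x : L, (p <= q `|` x) && ~~ (p <= lower_cover q `|` x)]].

(* [cycle join_dependency [:: p0; ...; pn]] also asserts the closing step from
   [pn] back to [p0], and holds vacuously of the empty sequence only. *)
Definition lower_bounded : Prop :=
  forall c : seq L, cycle join_dependency c -> c = [::].

End FiniteLattices.

Arguments atomistic {d} L.
Arguments lower_bounded {d} L.

(* Main.v *)
From HB Require Import structures.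
Require Import Defs.
From mathcomp Require Import all_boot all_order.

Set Implicit Arguments.
Unset Strict Implicit.
Unset Printing Implicit Defensive.

Import Order.LTheory.

Local Open Scope order_scope.

(** The argument rests on two facts about the join-dependency relation D of a
    finite lattice L, both obtained from [join_dependency_witness]: if p is
    join-irreducible and p <= x \/ u but not p <= u, then choosing w maximal
    among the elements above u and not above p, and e minimal among the
    elements below x and not below w, one gets a join-irreducible e <= x with
    e = p or p D e, and p <= e \/ w.

    First, sending a congruence R to the set [collapsed R] of the
    join-irreducible p congruent modulo R to their lower cover is an order
    isomorphism from Con L onto the sets of join-irreducible elements that are
    closed under D-predecessors ([collapsed_le], [collapsed_surj]).

    Second, a join-irreducible element never depends on exactly one element
    ([join_dependency_not_unique]).

    If L is lower bounded, D is acyclic, hence its reflexive transitive closure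
    is an order on the join-irreducible elements, and an isomorphism from Con L
    to H(P) identifies P with this ordered set: both are recovered from the
    principal closed sets ([collapsed_principal], [principal_collapsed]).  If
    (p, q) were a spike and x, y corresponded to p, q, then each z with x D z
    would correspond to some r > p, thus to an r >= q, thus to q by maximality.
    So x would depend on y and on nothing else, which is impossible.

    Conversely, let P be spike-free, and let L be the lattice of the subsets X
    of P such that c belongs to X whenever c < a and c < b for two distinct a, b
    in X.  Singletons belong to L, so L is atomistic and its join-irreducible
    elements are the singletons.  The union of such an X and of the principal
    down-set of q is again in L, so {p} D {q} implies p < q.  Conversely, if
    p < q, spike-freeness gives some r > p distinct from q, whence
    p is in {q} \/ {r} and {p} D {q}.  So D is the strict order of P; it is
    acyclic, and the closed sets describing Con L are the down-sets of P. *)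

(** * Finite posets and order isomorphisms *)

Section FinitePosets.
Context d (T : finPOrderType d).

Lemma exists_minimal_below (p : pred T) x : p x ->
  exists m, [/\ p m, m <= x & forall y, p y -> ~~ (y < m)].
Proof.
move=> px.
case: (@arg_minnP T x (fun y => p y && (y <= x))
         (fun y => #|[set z : T | z <= y]|)) => [|m]; first by rewrite px lexx.
move=> /andP[pm lemx] m_min.
exists m; split=> // y py; apply/negP => ltym.
have := m_min y; rewrite py (le_trans (ltW ltym) lemx) => /(_ isT).
rewrite leqNgt => /negP; apply; apply/proper_card/properP; split.
  by apply/subsetP => z; rewrite !inE => /le_trans; apply; apply: ltW.
by exists m; rewrite !inE ?lexx // lt_geF.
Qed.

Lemma exists_maximal_above (p : pred T) x : p x ->
  exists m, [/\ p m, x <= m & forall y, p y -> ~~ (m < y)].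
Proof.
move=> px.
case: (@arg_minnP T x (fun y => p y && (x <= y))
         (fun y => #|[set z : T | y <= z]|)) => [|m]; first by rewrite px lexx.
move=> /andP[pm lexm] m_min.
exists m; split=> // y py; apply/negP => ltmy.
have := m_min y; rewrite py (le_trans lexm (ltW ltmy)) => /(_ isT).
rewrite leqNgt => /negP; apply; apply/proper_card/properP; split.
  by apply/subsetP => z; rewrite !inE; apply: le_trans; apply: ltW.
by exists m; rewrite !inE ?lexx // lt_geF.
Qed.

Lemma exists_cover_below (x y : T) : x < y -> exists2 c, covers x c & c <= y.
Proof.
move=> ltxy; have [c [ltxc lecy c_min]] := @exists_minimal_below (> x) y ltxy.
exists c => //; apply/andP; split=> //; apply/forallP => z.
by apply/negP => /andP[/c_min/negPf->].
Qed.

Lemma exists_cover_above (x y : T) : x < y -> exists2 c, covers c y & x <= c.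
Proof.
move=> ltxy; have [c [ltcy lexc c_max]] := @exists_maximal_above (< y) x ltxy.
exists c => //; apply/andP; split=> //; apply/forallP => z.
by apply/negP => /andP[+ /c_max/negPf] => ->.
Qed.

End FinitePosets.

Lemma bijective_mono_lattice_isomorphic d d' (L : latticeType d)
    (L' : latticeType d') (f : L -> L') :
  bijective f -> {mono f : x y / x <= y} -> lattice_isomorphic L L'.
Proof.
move=> [g fK gK] f_mono.
have g_mono : {mono g : x y / x <= y} by move=> x y; rewrite -f_mono !gK.
have fI : Order.meet_morphism f.
  move=> x y; apply/le_anti/andP; split.
    by rewrite lexI !f_mono leIl leIr.
  by rewrite -g_mono fK lexI -2!f_mono gK leIl leIr.
have fU : Order.join_morphism f.
  move=> x y; apply/le_anti/andP; split.
    by rewrite -g_mono fK leUx -2!f_mono gK leUl leUr.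
  by rewrite leUx !f_mono leUl leUr.
have f_homo : {homo f : x y / x <= y} by move=> x y; rewrite f_mono.
pose om := Order.isOrderMorphism.Build _ _ _ _ f f_homo.
pose mm := Order.isMeetLatticeMorphism.Build _ _ _ _ f fI.
pose jm := Order.isJoinLatticeMorphism.Build _ _ _ _ f fU.
pose F : {lmorphism L -> L'} := HB.pack f om mm jm.
by exists F; exists g.
Qed.

Lemma lmorphism_inj_mono d d' (L : latticeType d) (L' : latticeType d')
    (f : {lmorphism L -> L'}) :
  injective f -> {mono f : x y / x <= y}.
Proof.
move=> f_inj x y; rewrite !leEmeet -omorphI; exact: inj_eq.
Qed.

(** * The join-dependency relation *)

Section JoinDependency.
Context d (L : finTBLatticeType d).
Implicit Types p q x y u v w : L.

Local Notation JI := (@join_irreducible d L).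
Local Notation D := (@join_dependency d L).

Lemma lt_lower_cover q x : JI q -> (x < q) = (x <= lower_cover q).
Proof.
move=> JIq; have Ecov := coversE JIq; apply/idP/idP => [ltxq | lexq].
  by have [c + lexc] := exists_cover_above ltxq; rewrite Ecov => /eqP <-.
apply: (le_lt_trans lexq).
by have := Ecov (lower_cover q); rewrite eqxx => /andP[].
Qed.

Lemma lower_cover_lt q : JI q -> lower_cover q < q.
Proof. by move=> JIq; rewrite lt_lower_cover. Qed.

(** A minimal element below [v] and not below [u] is join-irreducible. *)
Lemma join_irreducible_separation v u : ~~ (v <= u) ->
  exists e, [/\ JI e, e <= v, ~~ (e <= u) & lower_cover e <= u].
Proof.
move=> nlevu; pose sep e := (e <= v) && ~~ (e <= u).
have [|e [/andP[leev nleeu] _ e_min]] := @exists_minimal_below _ L sep v.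
  by rewrite /sep lexx.
have below_e x : x < e -> x <= u.
  move=> ltxe; have := e_min x; rewrite /sep (le_trans (ltW ltxe) leev) ltxe.
  by case: (x <= u) => // /(_ isT).
have JIe : JI e.
  apply/andP; split; first by apply: contraNneq nleeu => ->; apply: le0x.
  apply/'forall_forallP => x y; apply/implyP => /eqP Ee.
  apply: contraR nleeu; rewrite negb_or => /andP[nex ney].
  rewrite Ee leUx !below_e // lt_neqAle eq_sym ?nex ?ney Ee.
    exact: leUr.
  exact: leUl.
by exists e; split=> //; apply/below_e/lower_cover_lt.
Qed.

(** The source of join-dependencies: the relation [D p e] is exhibited by the
    element [w] itself. *)
Lemma join_dependency_witness p x u : JI p -> p <= x `|` u -> ~~ (p <= u) ->
  exists e w, [/\ JI e, e <= x, u <= w, p <= e `|` w & ~~ (p <= w)]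
              /\ (e != p -> D p e).
Proof.
move=> JIp lepxu nlepu.
have [w [nlepw leuw w_max]] :=
  @exists_maximal_above _ L (fun w => ~~ (p <= w) && (u <= w)) u
    (introT andP (conj nlepu (lexx u))).
have {}nlepw : ~~ (p <= w) by case/andP: nlepw.
have nlexw : ~~ (x <= w).
  apply: contra nlepw => lexw; apply: (le_trans lepxu).
  by rewrite leUx lexw.
have [e [JIe leex nleew lee_w]] := join_irreducible_separation nlexw.
have lepew : p <= e `|` w.
  have := w_max (e `|` w); rewrite lt_neqAle leUr andbT (le_trans leuw (leUr _ _)).
  by rewrite andbT eq_sym eq_joinr nleew; case: (p <= _) => // /(_ isT).
exists e, w; split=> // nep; apply/and4P; split=> //; first by rewrite eq_sym.
by apply/existsP; exists w; rewrite lepew (join_idPr lee_w).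
Qed.

(** If [p <= q \/ x] witnesses [D p q], the same inequality with the roles of
    [q] and [x] exchanged yields a dependency of [p] on some [e <= x] that is
    not below [q]. *)
Lemma join_dependency_not_unique p q : D p q -> exists2 r, D p r & r != q.
Proof.
case/and4P => JIp JIq npq /existsP[x /andP[lepqx nlepq_x]].
have nlepx : ~~ (p <= x).
  by apply: contra nlepq_x => lepx; apply: (le_trans lepx); apply: leUr.
have nlepq : ~~ (p <= q).
  apply: contra nlepq_x => lepq; apply: lexUl.
  by rewrite -lt_lower_cover // lt_neqAle npq.
have lepxq : p <= x `|` q by rewrite joinC.
have [e [w [[JIe leex leqw lepew nlepw] Dpe]]] :=
  join_dependency_witness JIp lepxq nlepq.
exists e.
  by apply: Dpe; apply: contraNneq nlepx => <-.
apply: contraNneq nlepw => eeq; move: lepew.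
by rewrite eeq (join_idPr leqw).
Qed.

(** Sets of join-irreducible elements that contain every [p] with [D p q] as
    soon as they contain [q]. *)
Definition dependency_closed (C : {set L}) : Prop :=
  {subset C <= JI} /\ (forall p q, D p q -> q \in C -> p \in C).

Lemma dependency_closed_connect C p q :
  dependency_closed C -> connect D p q -> q \in C -> p \in C.
Proof.
move=> [_ clC] /connectP[s + ->]; elim: s p => //= r s IHs p /andP[Dpr rs] qC.
exact: clC Dpr (IHs r rs qC).
Qed.

Lemma connect_join_irreducible p q : JI q -> connect D p q -> JI p.
Proof.
by move=> JIq /connectP[[|r s] /= ps Eq]; [rewrite -Eq | case/andP: ps => /andP[]].
Qed.

(** The least dependency-closed set containing a join-irreducible [q]: its
    elements are the starting points of the [D]-paths, possibly empty, that end
    at [q]. *)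
Definition dependents q : {set L} := [set p | connect D p q].

Lemma dependents_closed q : JI q -> dependency_closed (dependents q).
Proof.
move=> JIq; split=> [p|p r Dpr]; rewrite !inE; first exact: connect_join_irreducible.
exact/connect_trans/connect1.
Qed.

End JoinDependency.

(** * Congruences *)

Section CongruencesAndDependency.
Context d (L : finTBLatticeType d).
Implicit Types (p q x y z : L) (R S : congruence L) (C : {set L}).

Local Notation JI := (@join_irreducible d L).
Local Notation D := (@join_dependency d L).

Lemma congr_refl R x : (x, x) \in (R : {set _}).
Proof. by have /is_congruenceP[] := congruence_is_congruence R. Qed.

Lemma congr_sym R x y : (x, y) \in (R : {set _}) -> (y, x) \in (R : {set _}).
Proof. by have /is_congruenceP[_ + _ _] := congruence_is_congruence R; apply. Qed.

Lemma congr_trans R y x z : (x, y) \in (R : {set _}) ->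
  (y, z) \in (R : {set _}) -> (x, z) \in (R : {set _}).
Proof. by have /is_congruenceP[_ _ + _] := congruence_is_congruence R; apply. Qed.

Lemma congr_meetl R z x y : (x, y) \in (R : {set _}) ->
  (z `&` x, z `&` y) \in (R : {set _}).
Proof.
move=> xy; have /is_congruenceP[rR _ _ /(_ z z x y)] := congruence_is_congruence R.
by case.
Qed.

Lemma congr_joinl R z x y : (x, y) \in (R : {set _}) ->
  (z `|` x, z `|` y) \in (R : {set _}).
Proof.
move=> xy; have /is_congruenceP[rR _ _ /(_ z z x y)] := congruence_is_congruence R.
by case.
Qed.

(** The join-irreducible elements that [R] identifies with their unique lower
    cover. *)
Definition collapsed R : {set L} :=
  [set p | JI p && ((lower_cover p, p) \in (R : {set _}))].

(** To collapse [p] it is enough to identify it with any smaller element. *)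
Lemma mem_collapsed R p x : JI p -> x < p -> (x, p) \in (R : {set _}) ->
  p \in collapsed R.
Proof.
move=> JIp ltxp xp; rewrite inE JIp /=.
have lexp_ : x <= lower_cover p by rewrite -lt_lower_cover.
have := congr_joinl (lower_cover p) xp.
by rewrite (join_idPl lexp_) (join_idPr (ltW (lower_cover_lt JIp))).
Qed.

(** If [p <= q \/ x] but not [p <= q_* \/ x], identifying [q] with its lower
    cover [q_*] identifies [p] with [p /\ (q_* \/ x)], which is below [p]. *)
Lemma collapsed_closed R : dependency_closed (collapsed R).
Proof.
split=> [p|p q]; first by rewrite inE => /andP[].
case/and4P => JIp _ npq /existsP[x /andP[lepqx nlepq_x]].
rewrite inE => /andP[JIq q_q].
apply: (@mem_collapsed R p (p `&` (x `|` lower_cover q))) => //.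
  by rewrite lt_neqAle leIl andbT eq_meetl joinC.
have := congr_meetl p (congr_joinl x q_q).
by rewrite [p `&` (x `|` q)](meet_idPl _) // joinC.
Qed.

(** Congruent elements lie above the same join-irreducible elements, the
    collapsed ones excepted. *)
Lemma congr_le_above R p x y : (x, y) \in (R : {set _}) -> JI p ->
  p \notin collapsed R -> p <= x -> p <= y.
Proof.
move=> xy JIp nRp lepx; apply: contraNT nRp => nlepy.
apply: (@mem_collapsed R p (p `&` y)) => //.
  by rewrite lt_neqAle leIl andbT eq_meetl.
by have /congr_sym := congr_meetl p xy; rewrite (meet_idPl lepx).
Qed.

(** The interval from [u] to [v] is climbed within a single class of [R], each
    step joining one more collapsed element whose lower cover is already below
    the current element. *)
Lemma congr_of_collapsed R u v : u <= v ->
    (forall p, JI p -> p <= v -> ~~ (p <= u) -> p \in collapsed R) ->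
  (u, v) \in (R : {set _}).
Proof.
move=> leuv colR.
have [w [/and3P[leuw lewv uw] _ w_max]] :=
  @exists_maximal_above _ L (fun w => [&& u <= w, w <= v & (u, w) \in (R : {set _})]) u
    (introT and3P (And3 (lexx u) leuv (congr_refl R u))).
have [levw | /join_irreducible_separation[e [JIe leev nleew lee_w]]] :=
  boolP (v <= w).
  by rewrite (_ : v = w) //; apply/le_anti; rewrite levw.
have Re : (lower_cover e, e) \in (R : {set _}).
  have := colR e JIe leev; rewrite inE => /(_ _)/andP[] //.
  by apply: contra nleew => /le_trans; apply.
have := w_max (w `|` e); rewrite (le_trans leuw (leUl _ _)) leUx lewv leev /=.
have := congr_joinl w Re; rewrite (join_idPl lee_w) => /(congr_trans uw) -> /=.
by rewrite lt_neqAle leUl andbT eq_sym eq_joinl nleew => /(_ isT).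
Qed.

(** A congruence is determined, monotonically, by the elements it collapses. *)
Lemma collapsed_le R S : (R <= S) = (collapsed R \subset collapsed S).
Proof.
apply/idP/idP => [/subsetP leRS | /subsetP colRS].
  by apply/subsetP => p; rewrite !inE => /andP[-> /leRS].
apply/subsetP => -[x y] xy.
apply: (@congr_trans S (x `&` y)); first apply: congr_sym;
  apply: congr_of_collapsed; rewrite ?leIl ?leIr // => p JIp lep;
  rewrite lexI lep ?andbT /= => nlep; apply: colRS; apply: contraNT nlep => nRp.
- exact: congr_le_above xy JIp nRp lep.
- exact: congr_le_above (congr_sym xy) JIp nRp lep.
Qed.

Lemma collapsed_inj : injective collapsed.
Proof. by move=> R S E; apply/le_anti; rewrite !collapsed_le E subxx. Qed.

(** The congruence collapsing exactly [C] relates two elements when they lie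
    above the same join-irreducible elements outside [C]; compatibility with
    joins is where the closure of [C] is needed. *)
Lemma collapsed_surj C : dependency_closed C -> exists R, collapsed R = C.
Proof.
move=> [JIC clC].
pose E : {set L * L} := [set xy | [forall p, JI p && (p \notin C) ==>
                                     ((p <= xy.1) == (p <= xy.2))]].
have EP x y : reflect (forall p, JI p -> p \notin C -> (p <= x) = (p <= y))
                      ((x, y) \in E).
  rewrite inE; apply: (iffP forallP) => xy p.
    by move=> JIp nCp; have := xy p; rewrite JIp nCp => /eqP.
  by apply/implyP => /andP[JIp nCp]; apply/eqP/xy.
have joinE x y z p : (x, y) \in E -> JI p -> p \notin C ->
    p <= x `|` z -> p <= y `|` z.
  move=> /EP xy JIp nCp lepxz; apply: contraT => nleyz.
  have lepx : p <= x `|` (y `|` z).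
    by apply: (le_trans lepxz); rewrite leU2 // leUr.
  have [e [w [[JIe leex leyzw lepew nlepw] Dpe]]] :=
    join_dependency_witness JIp lepx nleyz.
  have nCe : e \notin C.
    have [-> // | nep] := eqVneq e p.
    by apply: contra nCp; apply: clC; apply: Dpe.
  have leew : e <= w by apply: le_trans leyzw; apply: lexUl; rewrite -xy.
  by move: lepew; rewrite (join_idPr leew) (negPf nlepw).
have congE : is_congruence E.
  have symE x y : (x, y) \in E -> (y, x) \in E.
    by move/EP => xy; apply/EP => p JIp nCp; rewrite xy.
  have transE x y z : (x, y) \in E -> (y, z) \in E -> (x, z) \in E.
    by move=> /EP xy /EP yz; apply/EP => p JIp nCp; rewrite xy ?yz.
  have joinlE x y z : (x, y) \in E -> (x `|` z, y `|` z) \in E.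
    move=> xy; apply/EP => p JIp nCp; apply/idP/idP; apply: joinE => //.
    exact: symE.
  apply/is_congruenceP; split=> //; first by move=> x; apply/EP.
  move=> x x' y y' xx' yy'; split.
    apply/EP => p JIp nCp; rewrite !lexI.
    by move/EP: xx' => -> //; move/EP: yy' => ->.
  apply: (transE _ (x' `|` y)); first exact: joinlE.
  by rewrite ![x' `|` _]joinC; apply: joinlE.
exists (Congruence congE); apply/setP => p; rewrite inE.
apply/andP/idP => [[JIp /EP Ep] | Cp].
  apply: contraT => nCp; have := Ep p JIp nCp.
  by rewrite lexx -lt_lower_cover // ltxx.
have JIp := JIC p Cp; split=> //; apply/EP => q JIq nCq.
rewrite -lt_lower_cover // le_eqVlt; case: eqVneq => // qp.
by rewrite -qp (negPf nCq) in Cp.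
Qed.

End CongruencesAndDependency.

(** * Spikes and lower bounded lattices *)

Section LowerBounded.
Context d (L : finTBLatticeType d).
Hypothesis L_lb : lower_bounded L.
Implicit Types p q x y : L.

Local Notation D := (@join_dependency d L).

Lemma lower_bounded_acyclic x y : D x y -> connect D y x -> False.
Proof.
move=> Dxy /connectP[s ys Ex].
suff /L_lb : cycle D (y :: s) by [].
by rewrite /= rcons_path ys -Ex.
Qed.

Lemma lower_bounded_connect_anti x y : connect D x y -> connect D y x -> x = y.
Proof.
case/connectP=> -[_ -> // | z s /= /andP[Dxz zs] Ey] Cyx.
case: (lower_bounded_acyclic Dxz); apply: connect_trans Cyx.
by apply/connectP; exists s.
Qed.

(** In a lower bounded lattice [connect D] is an order, whose principal
    down-sets determine their generators. *)
Lemma dependents_inj : injective (@dependents d L).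
Proof.
move=> x y Exy; apply: lower_bounded_connect_anti.
  by move/setP/(_ x): Exy; rewrite !inE connect0.
by move/setP/(_ y): Exy; rewrite !inE connect0.
Qed.

End LowerBounded.

Section PrincipalDownsets.
Context d (P : finPOrderType d).
Implicit Types (p q r : P) (A B : downset P).

Fact principal_downset_subproof p : hereditary [set r | r <= p].
Proof. by apply/hereditaryP => x y lexy; rewrite !inE; apply: le_trans. Qed.

(** The down-set of the elements below [p]. *)
Definition principal_downset p := Downset (principal_downset_subproof p).

Fact strict_downset_subproof p : hereditary [set r | r < p].
Proof. by apply/hereditaryP => x y lexy; rewrite !inE; apply: le_lt_trans. Qed.

(** The down-set of the elements strictly below [p], the greatest down-set
    properly contained in [principal_downset p]. *)
Definition strict_downset p := Downset (strict_downset_subproof p).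

Lemma principal_downset_le p A : (principal_downset p <= A) = (p \in (A : {set P})).
Proof.
apply/subsetP/idP => [-> //|pA r]; first by rewrite inE.
by rewrite inE => lerp; apply: (hereditaryP _ (downset_hereditary A)) lerp pA.
Qed.

Lemma principal_downset_mono : {mono principal_downset : p q / p <= q}.
Proof. by move=> p q; rewrite principal_downset_le inE. Qed.

End PrincipalDownsets.

Section SpikeFree.
Context d (L : finTBLatticeType d) d' (P : finPOrderType d').
Variables (f : congruence L -> downset P) (g : downset P -> congruence L).
Hypotheses (f_mono : {mono f : R S / R <= S}) (gK : cancel g f).
Implicit Types (x y : L) (p q r : P) (R S : congruence L).

Local Notation D := (@join_dependency d L).
Local Notation JI := (@join_irreducible d L).

Let g_mono : {mono g : A B / A <= B}.
Proof. by move=> A B; rewrite -f_mono !gK. Qed.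

Lemma dependents_collapsed R x : x \in collapsed R -> dependents x \subset collapsed R.
Proof.
move=> xR; apply/subsetP => y; rewrite inE => Cyx.
exact: dependency_closed_connect (collapsed_closed R) Cyx xR.
Qed.

(** An isomorphism between [Con L] and the down-sets of [P] carries principal
    down-sets to congruences generated by collapsing a single join-irreducible
    element: some [x] distinguishes the congruence of [principal_downset p] from
    that of [strict_downset p], and it generates the former. *)
Lemma collapsed_principal p :
  exists2 x, JI x & collapsed (g (principal_downset p)) = dependents x.
Proof.
set A := g _.
have /subsetPn[x xA nx] : ~~ (collapsed A \subset collapsed (g (strict_downset p))).
  by rewrite -collapsed_le g_mono principal_downset_le inE ltxx.
have JIx : JI x by move: xA; rewrite inE => /andP[].
exists x => //; apply/eqP; rewrite eqEsubset (dependents_collapsed xA) andbT.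
have [R ER] := collapsed_surj (dependents_closed JIx).
rewrite -ER -collapsed_le -f_mono gK principal_downset_le.
apply: contraR nx => npR.
have /subsetP := dependents_collapsed xA; rewrite -ER => /subsetP.
rewrite -collapsed_le -f_mono gK => /subsetP leR.
have : collapsed R \subset collapsed (g (strict_downset p)).
  rewrite -collapsed_le -f_mono gK; apply/subsetP => r rR; rewrite inE lt_neqAle.
  by have := leR r rR; rewrite inE => ->; rewrite andbT; apply: contraNneq npR => <-.
by rewrite ER => /subsetP; apply; rewrite inE connect0.
Qed.

(** Conversely, every congruence generated by collapsing a single
    join-irreducible element comes from a principal down-set; here [C] plays
    the part of the greatest closed set properly contained in [dependents x]. *)
Lemma principal_collapsed x : JI x ->
  exists p, collapsed (g (principal_downset p)) = dependents x.
Proof.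
move=> JIx; have [R ER] := collapsed_surj (dependents_closed JIx).
pose C := [set y in dependents x | ~~ connect D x y].
have clC : dependency_closed C.
  have [JIdx cldx] := dependents_closed JIx.
  split=> [y|y z Dyz]; rewrite !inE => /andP[Cyx nCxy].
    by apply: JIdx; rewrite inE.
  rewrite (connect_trans (connect1 Dyz) Cyx) /=.
  by apply: contra nCxy => /connect_trans; apply; apply: connect1.
have [S ES] := collapsed_surj clC.
have /subsetPn[p pR npS] : ~~ (f R <= f S).
  rewrite f_mono collapsed_le ER ES; apply/negP => /subsetP/(_ x).
  by rewrite !inE connect0 => /(_ isT).
have leAR : g (principal_downset p) <= R.
  by rewrite -f_mono gK principal_downset_le.
exists p; apply/eqP; rewrite eqEsubset -{1}ER -collapsed_le leAR /=.
apply: dependents_collapsed; apply: contraNT npS => nxA.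
rewrite -principal_downset_le -(gK (principal_downset p)) f_mono collapsed_le ES.
apply/subsetP => y yA; rewrite inE -ER; move: leAR; rewrite collapsed_le.
move=> /subsetP -> //=; apply: contra nxA => Cxy.
exact: dependency_closed_connect (collapsed_closed _) Cxy yA.
Qed.

Lemma lower_bounded_spike_free : lower_bounded L -> spike_free P.
Proof.
move=> L_lb p q [q_max /andP[ltpq _] q_uniq].
have [x JIx Ex] := collapsed_principal p.
have [y JIy Ey] := collapsed_principal q.
have le_dep r s a b : collapsed (g (principal_downset r)) = dependents a ->
    collapsed (g (principal_downset s)) = dependents b -> connect D a b = (r <= s).
  move=> Er Es; rewrite -principal_downset_mono -g_mono collapsed_le Er Es.
  apply/idP/subsetP => [Cab c | /(_ a)].
    by rewrite !inE => /connect_trans; apply.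
  by rewrite !inE connect0 => /(_ isT).
(* Every dependency of x corresponds to an element above p, hence to q. *)
have only_y z : D x z -> z = y.
  move=> Dxz; have /and4P[_ JIz _ _] := Dxz.
  have [r Er] := principal_collapsed JIz.
  have lepr : p <= r by rewrite -(le_dep _ _ _ _ Ex Er) connect1.
  have nlerp : ~~ (r <= p).
    by rewrite -(le_dep _ _ _ _ Er Ex); apply/negP/lower_bounded_acyclic.
  have ltpr : p < r by rewrite lt_leAnge lepr.
  have [c /q_uniq -> /q_max Erq] := exists_cover_below ltpr.
  by apply: dependents_inj => //; rewrite -Er -Ey Erq.
have: connect D x y by rewrite (le_dep _ _ _ _ Ex Ey) ltW.
case/connectP => -[_ Eyx | z s /= /andP[Dxz _] _].
  by move: ltpq; rewrite lt_leAnge -(le_dep _ _ _ _ Ey Ex) Eyx connect0 andbF.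
have [r /only_y -> /eqP] := join_dependency_not_unique Dxz.
by rewrite (only_y z).
Qed.

End SpikeFree.

(** * The lattice attached to a spike-free poset *)

Section Atoms.
Context d (L : finTBLatticeType d).
Implicit Types a x : L.

Lemma atom_le a x : atom a -> x <= a -> x = \bot \/ x = a.
Proof.
case/andP => _ /forallP a_min; rewrite le_eqVlt => /predU1P[-> | ltxa]; first by right.
by left; apply/eqP; have := a_min x; rewrite ltxa andbT lt0x negbK.
Qed.

Lemma atom_join_irreducible a : atom a -> join_irreducible a.
Proof.
move=> atom_a; have /andP[lt0a _] := atom_a.
rewrite /join_irreducible -lt0x lt0a; apply/'forall_forallP => x y.
apply/implyP => /eqP Ea.
have [Ex | ->] : x = \bot \/ x = a by apply: atom_le => //; rewrite Ea leUl.
  by rewrite {2}Ea Ex join0x eqxx orbT.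
by rewrite eqxx.
Qed.

Lemma atom_lower_cover a : atom a -> lower_cover a = \bot.
Proof.
move=> atom_a; apply/esym/eqP; rewrite -coversE //; exact: atom_join_irreducible.
Qed.

End Atoms.

Section PairClosedSets.
Context d (P : finPOrderType d).
Implicit Types (p q r : P) (A : {set P}).

(** Subsets of [P] containing every strict lower bound of any two of their
    distinct elements. *)
Definition pair_closed A : bool :=
  [forall a : P, forall b : P, forall c : P,
     [&& a \in A, b \in A, a != b, c < a & c < b] ==> (c \in A)].

Lemma pair_closedP A :
  reflect (forall a b c, a \in A -> b \in A -> a != b -> c < a -> c < b -> c \in A)
          (pair_closed A).
Proof.
apply: (iffP forallP) => [clA a b c aA bA nab ltca ltcb | clA a].
  move/forallP/(_ b)/forallP/(_ c)/implyP: (clA a).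
  by rewrite aA bA nab ltca ltcb; apply.
apply/forallP => b; apply/forallP => c; apply/implyP => /and5P[].
exact: clA.
Qed.

(** The lattice of pair-closed subsets, ordered by inclusion; joins are the
    closures of unions. *)
Record pairset := Pairset {
  pairset_set :> {set P};
  pairset_closed : pair_closed pairset_set
}.

HB.instance Definition _ := [isSub for pairset_set].
HB.instance Definition _ := [Finite of pairset by <:].

Implicit Types X Y Z : pairset.

Definition pairset_le X Y : bool := (X : {set P}) \subset Y.

Fact pairset_le_refl : reflexive pairset_le.
Proof. by move=> X; apply: subxx. Qed.

Fact pairset_le_anti : antisymmetric pairset_le.
Proof. by move=> X Y; rewrite /pairset_le -eqEsubset => /eqP/val_inj. Qed.

Fact pairset_le_trans : transitive pairset_le.
Proof. by move=> Y X Z; apply: subset_trans. Qed.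

HB.instance Definition _ :=
  Order.Le_isPOrder.Build Order.SetSubsetOrder.subset_display pairset
    pairset_le_refl pairset_le_anti pairset_le_trans.

Lemma pair_closed_bigcap (F : pred {set P}) :
  (forall A, F A -> pair_closed A) -> pair_closed (\bigcap_(A | F A) A).
Proof.
move=> clF; apply/pair_closedP => a b c /bigcapP aF /bigcapP bF nab ltca ltcb.
apply/bigcapP => A FA; have /pair_closedP clA := clF A FA.
by apply: clA nab ltca ltcb; [apply: aF | apply: bF].
Qed.

Fact pairset_meet_subproof X Y : pair_closed (X :&: Y).
Proof.
apply/pair_closedP => a b c; rewrite !inE => /andP[aX aY] /andP[bX bY] nab ltca ltcb.
have /pair_closedP clX := pairset_closed X; have /pair_closedP clY := pairset_closed Y.
by rewrite (clX a b) // (clY a b).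
Qed.

Fact pairset_join_subproof X Y :
  pair_closed (\bigcap_(A | pair_closed A && (X :|: Y \subset A)) A).
Proof. by apply: pair_closed_bigcap => A /andP[]. Qed.

Definition pairset_meet X Y := Pairset (pairset_meet_subproof X Y).
Definition pairset_join X Y := Pairset (pairset_join_subproof X Y).

Fact pairset_meetP X Y Z : (X <= pairset_meet Y Z) = (X <= Y) && (X <= Z).
Proof. exact: subsetI. Qed.

Fact pairset_joinP X Y Z : (pairset_join X Y <= Z) = (X <= Z) && (Y <= Z).
Proof.
rewrite -[RHS]subUset; apply/idP/idP => [|XYZ].
  by apply: subset_trans; apply/bigcapsP => A /andP[].
by apply: bigcap_inf; rewrite pairset_closed.
Qed.

HB.instance Definition _ :=
  Order.POrder_MeetJoin_isLattice.Build Order.SetSubsetOrder.subset_display pairset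
    pairset_meetP pairset_joinP.

Fact pair_closed0 : pair_closed set0.
Proof. by apply/pair_closedP => a b c; rewrite inE. Qed.

Fact pair_closedT : pair_closed setT.
Proof. by apply/pair_closedP => a b c _ _ _ _ _; rewrite inE. Qed.

Fact pairset_le0x X : Pairset pair_closed0 <= X.
Proof. exact: sub0set. Qed.

Fact pairset_lex1 X : X <= Pairset pair_closedT.
Proof. exact: subsetT. Qed.

HB.instance Definition _ :=
  Order.hasBottom.Build Order.SetSubsetOrder.subset_display pairset pairset_le0x.
HB.instance Definition _ :=
  Order.hasTop.Build Order.SetSubsetOrder.subset_display pairset pairset_lex1.

Fact pair_closed1 p : pair_closed [set p].
Proof.
by apply/pair_closedP => a b c; rewrite !inE => /eqP -> /eqP ->; rewrite eqxx.
Qed.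

(** Singletons contain no two distinct elements, hence are pair-closed. *)
Definition singleton p : pairset := Pairset (pair_closed1 p).

Lemma singleton_inj : injective singleton.
Proof. by move=> p q [/set1_inj]. Qed.

Lemma singleton_le p X : (singleton p <= X) = (p \in (X : {set P})).
Proof. exact: sub1set. Qed.

Lemma singleton_neq0 p : singleton p != \bot.
Proof. by apply/eqP => -[/setP/(_ p)]; rewrite !inE eqxx. Qed.

Lemma pairset_neq0 X : X != \bot -> exists p, p \in (X : {set P}).
Proof.
move=> nX0; apply/set0Pn; apply: contraNneq nX0 => X0; apply/eqP/val_inj.
exact: X0.
Qed.

Lemma singleton_atom p : atom (singleton p).
Proof.
rewrite /atom /covers lt0x singleton_neq0; apply/forallP => X; rewrite lt0x.
apply/negP => /andP[/pairset_neq0[r rX]]; rewrite lt_leAnge singleton_le.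
by case/andP => /subsetP/(_ r rX); rewrite inE => /eqP <-; rewrite rX.
Qed.

Lemma pairset_join_singletons X :
  X = \join_(Y in [set singleton p | p in (X : {set P})]) Y.
Proof.
apply/le_anti/andP; split; last first.
  by apply/joinsP => Y /imsetP[p pX ->]; rewrite singleton_le.
apply/subsetP => p pX; rewrite -singleton_le.
by apply: (@joins_sup _ _ _ _ _ id); apply: imset_f.
Qed.

Lemma pairset_atomistic : atomistic pairset.
Proof.
move=> X; exists [set singleton p | p in (X : {set P})].
  by move=> Y /imsetP[p _ ->]; apply: singleton_atom.
exact: pairset_join_singletons.
Qed.

(** Removing a maximal element from a pair-closed set leaves a pair-closed
    set, because strict lower bounds of its elements are never maximal. *)
Lemma join_irreducible_singleton X :
  join_irreducible X -> exists p, X = singleton p.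
Proof.
case/andP => /pairset_neq0[p0 p0X] /'forall_forallP JIX.
have [p [pX _ p_max]] :=
  @exists_maximal_above _ P (fun p => p \in (X : {set P})) p0 p0X.
have clY : pair_closed (X :\ p).
  apply/pair_closedP => a b c; rewrite !inE => /andP[_ aX] /andP[_ bX] nab ltca ltcb.
  have /pair_closedP clX := pairset_closed X; rewrite (clX a b) // andbT.
  by apply: contraTneq ltca => ->; apply: p_max.
have := JIX (singleton p) (Pairset clY).
have <- : X = singleton p `|` Pairset clY.
  have leYX : Pairset clY <= X by apply: subD1set.
  apply/le_anti; rewrite leUx singleton_le pX leYX !andbT.
  apply/subsetP => r rX; rewrite -singleton_le; have [-> | nrp] := eqVneq r p.
    exact: leUl.
  by apply: le_trans (leUr _ _); rewrite singleton_le !inE nrp.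
rewrite eqxx /= => /orP[/eqP -> | /eqP EX]; first by exists p.
by move: pX; rewrite EX !inE eqxx.
Qed.

(** The join of [singleton q] and [X] adds to [X] only elements below [q]. *)
Lemma join_dependency_singleton_lt p q :
  join_dependency (singleton p) (singleton q) -> p < q.
Proof.
case/and4P => _ _ npq /existsP[X].
rewrite (atom_lower_cover (singleton_atom q)) join0x.
rewrite !singleton_le => /andP[pqX npX].
have clU : pair_closed (X :|: [set r | r <= q]).
  apply/pair_closedP => a b c; rewrite !inE.
  case/orP => [aX | leaq]; last by move=> _ _ /ltW/le_trans->; rewrite ?orbT.
  case/orP => [bX | lebq]; last by move=> _ _ /ltW/le_trans->; rewrite ?orbT.
  have /pair_closedP clX := pairset_closed X.
  by move=> nab ltca ltcb; rewrite (clX a b).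
have leqXU : singleton q `|` X <= Pairset clU.
  have leXU : X <= Pairset clU by apply: subsetUl.
  by rewrite leUx leXU singleton_le !inE lexx orbT.
have := subsetP leqXU p pqX; rewrite !inE (negPf npX) /= lt_neqAle => ->.
by rewrite andbT; apply: contraNneq npq => ->.
Qed.

Lemma pairset_lower_bounded : lower_bounded pairset.
Proof.
(* The order of P transported to singletons contains the join-dependency
   relation; being transitive and irreflexive, it has no cycle. *)
pose ltS X Y := [exists p, exists q, [&& X == singleton p, Y == singleton q & p < q]].
have ltSP X Y : reflect (exists p q, [/\ X = singleton p, Y = singleton q & p < q])
                        (ltS X Y).
  apply: (iffP 'exists_existsP) => -[p [q]].
    by case/and3P => /eqP -> /eqP -> ltpq; exists p, q.
  by case=> -> -> ltpq; exists p, q; rewrite !eqxx.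
have ltS_trans : transitive ltS.
  move=> Y X Z /ltSP[p [q [-> -> ltpq]]] /ltSP[q' [r [/singleton_inj <- -> ltqr]]].
  by apply/ltSP; exists p, r; split=> //; apply: lt_trans ltqr.
have D_ltS : subrel (@join_dependency _ pairset) ltS.
  move=> X Y DXY; have /and4P[JIX JIY _ _] := DXY.
  have [p Ep] := join_irreducible_singleton JIX.
  have [q Eq] := join_irreducible_singleton JIY.
  apply/ltSP; exists p, q; split=> //.
  by apply: join_dependency_singleton_lt; rewrite -Ep -Eq.
case=> // X s /= /(sub_path D_ltS)/(order_path_min ltS_trans).
rewrite all_rcons => /andP[/ltSP[p [q [-> /singleton_inj <-]]]].
by rewrite ltxx.
Qed.

(** If [q] were the only element strictly above [p], then [q] would be maximal
    and the unique cover of [p]. *)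
Lemma spike_free_upper_bound p q :
  spike_free P -> p < q -> exists2 r, p < r & r != q.
Proof.
move=> sfP ltpq; have [/existsP[r /andP[]] | no_r] :=
  boolP [exists r, (p < r) && (r != q)]; first by exists r.
have uniq r : p < r -> r = q.
  move=> ltpr; apply/eqP; apply: contraNT no_r => nrq.
  by apply/existsP; exists r; rewrite ltpr.
case: (sfP p q); split.
- move=> r leqr; apply: uniq; exact: lt_le_trans leqr.
- apply/andP; split=> //; apply/forallP => z; apply/negP => /andP[/uniq ->].
  by rewrite ltxx.
- by move=> r /andP[/uniq].
Qed.

Lemma lt_join_dependency_singleton p q :
  spike_free P -> p < q -> join_dependency (singleton p) (singleton q).
Proof.
move=> sfP ltpq; have [r ltpr nrq] := spike_free_upper_bound sfP ltpq.
apply/and4P; split; try exact/atom_join_irreducible/singleton_atom.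
  by rewrite (inj_eq singleton_inj); apply: contraTneq ltpq => ->; rewrite ltxx.
apply/existsP; exists (singleton r).
rewrite (atom_lower_cover (singleton_atom q)) join0x !singleton_le inE.
rewrite (lt_eqF ltpr) andbT.
have /pair_closedP cl := pairset_closed (singleton q `|` singleton r).
apply: (cl q r) => //; rewrite -?singleton_le ?leUl ?leUr //.
by rewrite eq_sym.
Qed.

Section SpikeFreeCongruences.
Hypothesis sfP : spike_free P.
Implicit Types R S : congruence pairset.

Fact collapsed_points_subproof R : hereditary [set p | singleton p \in collapsed R].
Proof.
apply/hereditaryP => p q; rewrite le_eqVlt !inE => /predU1P[-> // | ltpq] qR.
have [_ clR] := collapsed_closed R.
by have := clR _ _ (lt_join_dependency_singleton sfP ltpq); rewrite !inE; apply.
Qed.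

(** The points of [P] whose singletons are collapsed by [R]; as the
    join-irreducible elements are the singletons, this is [collapsed R]
    transported to [P]. *)
Definition collapsed_points R : downset P := Downset (collapsed_points_subproof R).

Lemma collapsed_points_mono : {mono collapsed_points : R S / R <= S}.
Proof.
move=> R S; rewrite collapsed_le; apply/subsetP/subsetP => le_RS.
  move=> X XR; have JIX : join_irreducible X by move: XR; rewrite inE => /andP[].
  have [p EX] := join_irreducible_singleton JIX; rewrite EX in XR *.
  by have := le_RS p; rewrite ![p \in _]inE; apply.
by move=> p; rewrite ![p \in _]inE; apply: le_RS.
Qed.

Lemma collapsed_points_surj (A : downset P) : exists R, collapsed_points R = A.
Proof.
have [|R ER] := @collapsed_surj _ pairset [set singleton p | p in (A : {set P})].
  split=> [_ /imsetP[p _ ->]|X Y DXY /imsetP[q qA Eq]].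
    exact/atom_join_irreducible/singleton_atom.
  have /and4P[/join_irreducible_singleton[p Ep] _ _ _] := DXY.
  rewrite Ep imset_f //; apply: (hereditaryP _ (downset_hereditary A)) qA.
  by apply/ltW/join_dependency_singleton_lt; rewrite -Ep -Eq.
exists R; apply/val_inj/setP => p /=.
by rewrite [LHS]inE ER mem_imset //; apply: singleton_inj.
Qed.

Lemma congruence_pairset_isomorphic :
  lattice_isomorphic (congruence pairset) (downset P).
Proof.
have [g gK] := fin_all_exists collapsed_points_surj.
apply: (bijective_mono_lattice_isomorphic (f := collapsed_points)).
  exists g => //; apply: inj_can_sym gK _.
  exact: inc_inj collapsed_points_mono.
exact: collapsed_points_mono.
Qed.

End SpikeFreeCongruences.

End PairClosedSets.

Theorem corollary5p5 (d : Order.disp_t) (P : finPOrderType d) :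
  [<-> (exists (d' : Order.disp_t) (L : finTBLatticeType d'),
          [/\ atomistic L, lower_bounded L
            & lattice_isomorphic (congruence L) (downset P)]);
       (exists (d' : Order.disp_t) (L : finTBLatticeType d'),
          lower_bounded L /\ lattice_isomorphic (congruence L) (downset P));
       spike_free P].
Proof.
tfae.
- by move=> [d' [L [_ L_lb isoL]]]; exists d', L.
- move=> [d' [L [L_lb [f [g fK gK]]]]].
  exact: lower_bounded_spike_free (lmorphism_inj_mono (can_inj fK)) gK L_lb.
- move=> sfP; exists Order.SetSubsetOrder.subset_display, (pairset P).
  split; [exact: pairset_atomistic | exact: pairset_lower_bounded |].
  exact: congruence_pairset_isomorphic.
Qed.
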